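(* Let $n \ge 1$, $1 \le k \le n$, and $U \in \{\pm X, \pm Y, \pm Z\}$, and let $U_k = I^{\otimes (k-1)} \otimes U \otimes I^{\otimes (n-k)}$, acting on $(\mathbb{C}^2)^{\otimes n}$. Then every state of type $U_k$, i.e. every eigenstate of $U_k$, is separable in the sense that the $k$-th tensor factor (the one associated with $U$) is unentangled with the rest of the system.
   Context: $X = \begin{pmatrix}0&1\\1&0\end{pmatrix}$, $Y = \begin{pmatrix}0&-i\\i&0\end{pmatrix}$, $Z = \begin{pmatrix}1&0\\0&-1\end{pmatrix}$ are the Pauli matrices and $I$ is the $2\times 2$ identity matrix. An $n$-qubit state (nonzero vector in $(\mathbb{C}^2)^{\otimes n}$) has type $A$, for $A$ an operator on $(\mathbb{C}^2)^{\otimes n}$, if it is an eigenstate of $A$, i.e. $A|\phi\rangle = \lambda|\phi\rangle$ for some $\lambda \in \mathbb{C}$. The $k$-th factor of a state $|\phi\rangle$ is unentangled with the rest of the system if, under the canonical identification $(\mathbb{C}^2)^{\otimes n} \cong \mathbb{C}^2 \otimes (\mathbb{C}^2)^{\otimes (n-1)}$ that moves the $k$-th factor to the front and keeps the order of the others, $|\phi\rangle$ is a pure tensor $|u\rangle \otimes |\psi\rangle$ with $|u\rangle \in \mathbb{C}^2$ and $|\psi\rangle \in (\mathbb{C}^2)^{\otimes (n-1)}$ (where $(\mathbb{C}^2)^{\otimes 0} = \mathbb{C}$). *)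

(* Defs.v *)
From HB Require Import structures.
From mathcomp Require Import all_boot all_order all_algebra.
From mathcomp Require Import reals.
From mathcomp Require Import complex mxtens.
Set Implicit Arguments.
Unset Strict Implicit.
Unset Printing Implicit Defensive.
Import Order.TTheory GRing.Theory Num.Theory.
Local Open Scope ring_scope.

(* The complex field is R[i] with R : realType. The space (C^2)^{(x) n} is    *)
(* 'cV[R[i]]_(2 ^ n), whose coordinates are taken in the product basis        *)
(* ordered as by the Kronecker product *t (first factor most significant).    *)
(* Tensor factors are numbered by k : 'I_n, hence from 0: there are k factors *)
(* before the distinguished one and n - k.+1 after it.                        *)

Section Pauli.
Variable R : realType.

Definition mx2 (a b c d : R[i]) : 'M[R[i]]_2 :=
  \matrix_(i, j) if i == 0 then (if j == 0 then a else b)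
                           else (if j == 0 then c else d).

Definition pauliX : 'M[R[i]]_2 := mx2 0 1 1 0.
Definition pauliY : 'M[R[i]]_2 := mx2 0 (- 'i%C) 'i%C 0.
Definition pauliZ : 'M[R[i]]_2 := mx2 1 0 0 (-1).

End Pauli.

Arguments pauliX {R}.
Arguments pauliY {R}.
Arguments pauliZ {R}.

Lemma split_dim n (k : 'I_n) : (2 ^ k * 2 * 2 ^ (n - k.+1) = 2 ^ n)%N.
Proof. by rewrite -expnSr -expnD subnKC. Qed.

Lemma rest_dim n (k : 'I_n) : (2 ^ k * 2 ^ (n - k.+1) = 2 ^ n.-1)%N.
Proof.
rewrite -expnD; congr expn.
by case: n k => [[]|n] // k; rewrite subnKC // -ltnS.
Qed.

Section Qubits.
Variables (R : realType) (n : nat).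
Implicit Types (k : 'I_n) (A : 'M[R[i]]_(2 ^ n)) (phi : 'cV[R[i]]_(2 ^ n)).

Definition local_op k (U : 'M[R[i]]_2) : 'M[R[i]]_(2 ^ n) :=
  castmx (split_dim k, split_dim k)
    ((1%:M : 'M_2) ^t k *t U *t (1%:M : 'M_2) ^t (n - k.+1)).

Definition state_of_type A phi : Prop :=
  phi <> 0 /\ exists lambda : R[i], A *m phi = lambda *: phi.

(* The isomorphism x (x) u (x) y |-> u (x) (x (x) y), given on coordinates.   *)
Definition middle_to_front (m p : nat) (v : 'cV[R[i]]_(m * 2 * p)) :
    'cV[R[i]]_(2 * (m * p)) :=
  \col_i let: (b, ac) := mxtens_unindex i in
         let: (a, c) := mxtens_unindex ac in
         v (mxtens_index (mxtens_index (a, b), c)) 0.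

Definition to_front k phi : 'cV[R[i]]_(2 * 2 ^ n.-1) :=
  castmx (congr1 (muln 2) (rest_dim k), erefl 1%N)
    (middle_to_front (castmx (esym (split_dim k), erefl 1%N) phi)).

Definition unentangled k phi : Prop :=
  exists (u : 'cV[R[i]]_2) (psi : 'cV[R[i]]_(2 ^ n.-1)),
    to_front k phi = u *t psi.

Lemma middle_to_front_tens (m p : nat)
    (x : 'cV[R[i]]_m) (u : 'cV[R[i]]_2) (y : 'cV[R[i]]_p) :
  middle_to_front (x *t u *t y) = u *t (x *t y).
Proof.
apply/colP => i; case: (mxtens_indexP i) => b ac.
case: (mxtens_indexP ac) => a c.
rewrite !mxE !mxtens_indexK /= !mxE !mxtens_indexK /= [RHS]mulrCA -mulrA.
by congr (x a _ * (u b _ * y c _)); apply: etrans (ord1 _) (esym (ord1 _)).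
Qed.

Lemma to_front_tens k (x : 'cV[R[i]]_(2 ^ k)) (u : 'cV[R[i]]_2)
    (y : 'cV[R[i]]_(2 ^ (n - k.+1))) :
  to_front k (castmx (split_dim k, erefl 1%N) (x *t u *t y)) =
  u *t castmx (rest_dim k, erefl 1%N) (x *t y).
Proof.
rewrite /to_front castmx_comp castmx_id middle_to_front_tens.
by case: _ / (rest_dim k).
Qed.

End Qubits.

(* Main.v *)
Require Import Defs.
From HB Require Import structures.
From mathcomp Require Import all_boot all_order all_algebra.
From mathcomp Require Import reals.
From mathcomp Require Import complex mxtens.
Import Order.TTheory GRing.Theory Num.Theory.
Local Open Scope ring_scope.

(* Cut along the k-th factor, an eigenstate of U_k is a family of vectors of
   C^2 that all lie in one eigenspace of U.  As U is not scalar, that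
   eigenspace is at most a line, so the family is a multiple of one vector. *)

Lemma big_mxtens_index (V : nmodType) (m n : nat) (F : 'I_(m * n) -> V) :
  \sum_i F i = \sum_a \sum_b F (mxtens_index (a, b)).
Proof.
rewrite pair_big (reindex (@mxtens_index m n)) /=; last first.
  by apply: onW_bij; exists (@mxtens_unindex m n);
    [exact: mxtens_indexK | exact: mxtens_unindexK].
by apply: eq_bigr => -[].
Qed.

Lemma tensmx11 (K : comPzRingType) (m n : nat) :
  (1%:M : 'M[K]_m) *t (1%:M : 'M[K]_n) = 1%:M.
Proof.
apply/matrixP => i j.
case: (mxtens_indexP i) => a b; case: (mxtens_indexP j) => c d.
rewrite tensmxE !mxE (can_eq (@mxtens_indexK m n)) xpair_eqE.
by rewrite -natrM mulnb.
Qed.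

Lemma ntensmx11 (K : comPzRingType) (m n : nat) :
  (1%:M : 'M[K]_m) ^t n = 1%:M.
Proof.
(* The tensor power has base cases at exponents 0 and 1, so the induction starts at 1. *)
case: n => [//|n]; elim: n => [//|n IHn].
by rewrite ntensmxSS IHn tensmx11.
Qed.

(** The identity factors kill every term whose outer indices differ from [a] and [c], so [U] acts
    separately on each slice with [a] and [c] fixed. *)
Lemma mul_tens_middle (K : comPzRingType) (m n p : nat) (U : 'M[K]_n)
    (v : 'cV[K]_(m * n * p)) (a : 'I_m) (b : 'I_n) (c : 'I_p) :
  ((1%:M *t U *t 1%:M) *m v) (mxtens_index (mxtens_index (a, b), c)) 0 =
  \sum_b' U b b' * v (mxtens_index (mxtens_index (a, b'), c)) 0.
Proof.
rewrite mxE !big_mxtens_index (bigD1 a) //= [X in _ + X]big1 ?addr0.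
  apply: eq_bigr => b' _; rewrite (bigD1 c) //= [X in _ + X]big1 ?addr0.
    by rewrite !tensmxE !mxE !eqxx mul1r mulr1.
  by move=> c' c'c; rewrite !tensmxE !mxE (eq_sym c) (negPf c'c) mulr0 mul0r.
move=> a' a'a; rewrite big1 // => b' _; rewrite big1 // => c' _.
by rewrite !tensmxE !mxE (eq_sym a) (negPf a'a) !mul0r.
Qed.

(** One nonzero entry of [U - l%:M] suffices: its row [b] gives, for all [a] and [c], the same
    linear relation between the two middle coordinates of [v], which determines coordinate [j] from
    the other one. *)
Lemma middle_eigenvector_tens (R : realType) (m p : nat) (U : 'M[R[i]]_2)
    (l : R[i]) (v : 'cV[R[i]]_(m * 2 * p)) :
  U != l%:M -> (1%:M *t U *t 1%:M) *m v = l *: v ->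
  exists (u : 'cV[R[i]]_2) (psi : 'cV[R[i]]_(m * p)),
    middle_to_front v = u *t psi.
Proof.
rewrite -subr_eq0 => /matrix0Pn [b [j nz]] eigv.
have eigU a c :
    \sum_b' (U - l%:M) b b' * v (mxtens_index (mxtens_index (a, b'), c)) 0 = 0.
  under eq_bigr do rewrite !mxE mulrBl.
  rewrite sumrB -mul_tens_middle eigv mxE (bigD1 b) //= [X in _ - (_ + X)]big1.
    by rewrite eqxx mulr1n addr0 subrr.
  by move=> b' b'b; rewrite eq_sym (negPf b'b) mul0r.
(* [j'] is the index in ['I_2] other than [j]. *)
move: (U - l%:M) nz eigU => w nz eigU; pose j' := lift j (0 : 'I_1).
(* The vector [u] spans the kernel of row [b] of [w], scaled to have coordinate 1 at [j']; hence
   [psi] must be the slice of [v] at [j']. *)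
exists (\col_b' (if b' == j then - (w b j' / w b j) else 1)).
exists (\col_ac let: (a, c) := mxtens_unindex ac in
         v (mxtens_index (mxtens_index (a, j'), c)) 0).
apply/colP => i; case: (mxtens_indexP i) => b' ac.
case: (mxtens_indexP ac) => a c.
rewrite !mxE !mxtens_indexK /=.
case: (unliftP j b') => [k|] ->.
  by rewrite (ord1 k) eq_sym (negPf (neq_lift j 0)) mul1r.
(* Multiplied by [w b j], the claim at index [j] is the relation [eigU]. *)
rewrite eqxx; apply: (mulfI nz).
have := eigU a c; rewrite (bigD1_ord j) //= big_ord1.
move/eqP; rewrite addr_eq0 => /eqP ->.
by rewrite mulrA mulrN mulrCA divff // mulr1 mulNr.
Qed.

(** The entry at [0 1] rules out X and Y; for Z the two diagonal entries would make [l] equal to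
    both 1 and -1. *)
Lemma pauli_not_scalar (R : realType) (U : 'M[R[i]]_2) (l : R[i]) :
  U \in [:: pauliX; - pauliX; pauliY; - pauliY; pauliZ; - pauliZ] ->
  U != l%:M.
Proof.
have i_neq0 : ('i%C : R[i]) != 0 by rewrite eq_complex /= oner_eq0 andbF.
have N1_neq1 : (-1 : R[i]) != 1
  by rewrite eq_sym -subr_eq0 opprK -[1 + 1]/(2%:R) pnatr_eq0.
rewrite !inE => hU; apply/eqP => Ul; move: hU; rewrite Ul.
case/or4P => [||| /or3P[]] /eqP/matrixP E; move: (E 0 1) (E 0 0) (E 1 1);
  rewrite !mxE /= ?mulr0n ?mulr1n ?oppr0 ?opprK => /eqP e01 e00 e11.
- by rewrite eq_sym oner_eq0 in e01.
- by rewrite eq_sym oppr_eq0 oner_eq0 in e01.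
- by rewrite eq_sym oppr_eq0 (negPf i_neq0) in e01.
- by rewrite eq_sym (negPf i_neq0) in e01.
- by move: N1_neq1; rewrite -e11 e00 eqxx.
- by move: N1_neq1; rewrite -e00 e11 eqxx.
Qed.

(** Carries the eigenvalue equation from size [2 ^ n] to the factored size, where the middle index
    is visible. *)
Lemma mulmx_cast_eigen (K : comPzRingType) (m n : nat) (e : m = n)
    (A : 'M[K]_m) (l : K) (v : 'cV[K]_n) :
  castmx (e, e) A *m v = l *: v ->
  A *m castmx (esym e, erefl 1%N) v = l *: castmx (esym e, erefl 1%N) v.
Proof. by case: n / e v => v; rewrite !castmx_id. Qed.

Theorem corollary1 (R : realType) (n : nat) (k : 'I_n) (U : 'M[R[i]]_2)
    (hU : U \in [:: pauliX; - pauliX; pauliY; - pauliY; pauliZ; - pauliZ])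
    (phi : 'cV[R[i]]_(2 ^ n)) (hphi : state_of_type (local_op k U) phi) :
  unentangled k phi.
Proof.
case: hphi => _ [l]; rewrite /local_op !ntensmx11 => /mulmx_cast_eigen eigv.
have Ul := pauli_not_scalar _ _ l hU.
have [u [psi uv]] := middle_eigenvector_tens _ _ _ _ _ _ Ul eigv.
exists u, (castmx (rest_dim k, erefl 1%N) psi); rewrite /to_front uv.
(* Destructing the size equation turns both casts into identities. *)
by case: _ / (rest_dim k).
Qed.
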